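(* Suppose that $\{\gamma_n\}_{n\ge 0}$ is a monotone increasing sequence of real numbers, not identically zero, with $\gamma_0=0$, satisfying $$\gamma_{n+2}-2\gamma_{n+1}+\gamma_n\le 0\quad\text{for all } n\ge 0.$$ Let $F\in X_\gamma$ have a finite number of zeros inside the unit disc $\mathbb{D}$, labeled $\alpha_1,\dots,\alpha_m$ (listed with multiplicity), with Blaschke decomposition $F=B\cdot G$. Then $$\|G(e^{i\cdot})\|_{X_\gamma}^2\le \|F(e^{i\cdot})\|_{X_\gamma}^2-\sum_{j=1}^m\left((1-|\alpha_j|^2)\left\|\frac{F(e^{i\cdot})}{e^{i\cdot}-\alpha_j}\right\|_{Y_\gamma}^2\right).$$
   Context: $\mathbb{D}$ is the open unit disc and $\mathcal{H}^2=\mathcal{H}^2(\mathbb{D})$ is the Hardy space of analytic functions $F(z)=\sum_{n\ge0}a_nz^n$ on $\mathbb{D}$ with $\|F\|_{\mathcal{H}^2}^2=\sum_{n\ge0}|a_n|^2<\infty$. ''Monotone increasing'' means nondecreasing. For $F(z)=\sum_{j\ge0}a_jz^j\in\mathcal{H}^2$ put $$\|F\|_{X_\gamma}^2=\sum_{j\ge0}\gamma_j|a_j|^2,\qquad \|F\|_{Y_\gamma}^2=\sum_{j\ge0}(\gamma_{j+1}-\gamma_j)|a_j|^2,$$ and $X_\gamma$ (resp. $Y_\gamma$) is the set of $F\in\mathcal{H}^2$ for which the first (resp. second) quantity is finite. A function $h(e^{i\cdot})$ on the circle is identified with the analytic function $h(z)$ on $\mathbb{D}$ of which it is the boundary function;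 norms are computed from the Taylor coefficients of $h$. In particular $\frac{F(e^{i\cdot})}{e^{i\cdot}-\alpha_j}$ stands for $z\mapsto F(z)/(z-\alpha_j)$, analytic in $\mathbb{D}$ after removing the singularity at $\alpha_j$. Blaschke decomposition: if $F$ has zeros $\alpha_1,\dots,\alpha_m$ in $\mathbb{D}$ (repeated according to multiplicity), then $F=B\cdot G$ with $B(z)=\prod_{j=1}^m\frac{z-\alpha_j}{1-\overline{\alpha_j}z}$ and $G\in\mathcal{H}^2$ without zeros in $\mathbb{D}$ ($B$ and $G$ are determined up to a unimodular constant, which does not affect the norms). *)

(* Defs.v *)
From mathcomp Require Export all_boot all_order all_algebra complex.
From mathcomp Require Export all_classical all_reals all_analysis.

Set Implicit Arguments.
Unset Strict Implicit.
Unset Printing Implicit Defensive.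

Import Order.TTheory GRing.Theory Num.Theory.
Import numFieldNormedType.Exports.
Import ComplexField.Normc.

Local Open Scope classical_set_scope.
Local Open Scope ring_scope.

(* The regular alias [^o] is what carries the topology of [R[i]]. *)
Notation Cplx R := (complex R)^o.

(* The order of [R[i]] is partial, with [x < y] forcing [x] and [y] to have the
   same imaginary part; on norms it is the order of the reals. *)
Definition disc (R : realType) : set (Cplx R) := [set z | `|z| < 1].

Definition has_taylor (R : realType) (F : Cplx R -> Cplx R)
    (a : nat -> Cplx R) : Prop :=
  forall z, disc z -> series (fun n => a n * z ^+ n : Cplx R) @ \oo --> F z.

Definition analytic_on_disc (R : realType) (F : Cplx R -> Cplx R) : Prop :=
  exists a, has_taylor F a.

(* For [F] analytic on the disc the coefficients are unique, so [xget] selects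
   the Taylor coefficients of [F] at 0; the default value is never used. *)
Definition taylor_coef (R : realType) (F : Cplx R -> Cplx R) : nat -> Cplx R :=
  xget (fun=> 0) [set a | has_taylor F a].

(* [\sum_n w_n |a_n|^2], with values in the extended reals. *)
Definition wnorm2 (R : realType) (w : nat -> R) (F : Cplx R -> Cplx R) :
    \bar R :=
  (\sum_(0 <= n <oo) (w n * normc (taylor_coef F n) ^+ 2)%:E)%E.

Definition hardy2 (R : realType) (F : Cplx R -> Cplx R) : Prop :=
  analytic_on_disc F /\ (wnorm2 (fun=> 1%R) F < +oo)%E.

Definition normX2 (R : realType) (gamma : nat -> R) (F : Cplx R -> Cplx R) :
    \bar R :=
  wnorm2 gamma F.

Definition normY2 (R : realType) (gamma : nat -> R) (F : Cplx R -> Cplx R) :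
    \bar R :=
  wnorm2 (fun n => gamma n.+1 - gamma n) F.

Definition spaceX (R : realType) (gamma : nat -> R) : set (Cplx R -> Cplx R) :=
  [set F | hardy2 F /\ (normX2 gamma F < +oo)%E].

(* Order 0 means [F a != 0]. *)
Definition zero_of_order (R : realType) (F : Cplx R -> Cplx R) (a : Cplx R)
    (k : nat) : Prop :=
  exists H : Cplx R -> Cplx R,
    [/\ analytic_on_disc H, H a != 0 &
        forall z, disc z -> F z = (z - a) ^+ k * H z].

Definition zeros_in_disc (R : realType) (F : Cplx R -> Cplx R)
    (s : seq (Cplx R)) : Prop :=
  (forall a, a \in s -> disc a) /\
  (forall z, disc z -> zero_of_order F z (count_mem z s)).

Definition blaschke (R : realType) (s : seq (Cplx R)) (z : Cplx R) : Cplx R :=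
  \prod_(a <- s) ((z - a) / (1 - a^*%C * z)).

Definition blaschke_decomposition (R : realType) (F : Cplx R -> Cplx R)
    (s : seq (Cplx R)) (G : Cplx R -> Cplx R) : Prop :=
  [/\ hardy2 G, forall z, disc z -> G z != 0 &
      forall z, disc z -> F z = blaschke s z * G z].

(* [z |-> F z / (z - a)], with the singularity at [a] removed by continuity. *)
Definition div_root (R : realType) (F : Cplx R -> Cplx R) (a z : Cplx R) :
    Cplx R :=
  if z == a then lim (F w / (w - a) @[w --> a^']) else F z / (z - a).

(* Main.v *)
Require Import Defs.
From mathcomp Require Import ring lra.

(* For a single zero [a], put [h = G / (1 - a^* z)], so that
   [F = (z - a) h] and [G = (1 - a^* z) h].  Expanding the squares of the
   coefficients gives
     [|F_n|^2 - |G_n|^2 = (1 - |a|^2) (|h_(n-1)|^2 - |h_n|^2)].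
   Weighting by [gamma_n] and summing by parts turns this into
   [|F|_X^2 - |G|_X^2 = (1 - |a|^2) |h|_Y^2], up to a boundary term
   [gamma_N |h_N|^2] which is small infinitely often because [gamma_N = O(N)]
   and [h] is square summable.  The same identity with the nonincreasing weights
   [gamma_(n+1) - gamma_n] shows that multiplication by a Blaschke factor
   contracts the [Y] norm, so the zeros can be peeled off one at a time. *)

Set Implicit Arguments.
Unset Strict Implicit.
Unset Printing Implicit Defensive.

Import Order.TTheory GRing.Theory Num.Theory.
Import numFieldNormedType.Exports.
Import ComplexField.Normc.

Local Open Scope classical_set_scope.
Local Open Scope ring_scope.

(** * Coefficient sequences *)

Section FormalOperators.
Variable K : comNzRingType.
Implicit Types (a b : K) (g h : nat -> K) (n : nat).

(** With a sequence read as the coefficients of a power series, this is multiplication by [z];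
    [mul_Xsub] is multiplication by [z - a], and [div_1sub] is division by [1 - b z]. *)
Definition delay h n : K := if n is m.+1 then h m else 0.

Definition mul_Xsub a h n : K := delay h n - a * h n.

Fixpoint div_1sub b g n : K :=
  if n is m.+1 then g n + b * div_1sub b g m else g 0%N.

Lemma div_1subK b g n : div_1sub b g n - b * delay (div_1sub b g) n = g n.
Proof. by case: n => [|n] /=; ring. Qed.

Lemma mul_Xsub_comm a c h n :
  mul_Xsub a (mul_Xsub c h) n = mul_Xsub c (mul_Xsub a h) n.
Proof. by rewrite /mul_Xsub; case: n => [|[|n]] /=; ring. Qed.

Lemma div_1sub_mul_Xsub b c h n :
  div_1sub b (mul_Xsub c h) n = mul_Xsub c (div_1sub b h) n.
Proof.
elim: n => [|n IHn]; first by rewrite /mul_Xsub /=; ring.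
by rewrite /= IHn /mul_Xsub; case: n {IHn} => [|n] /=; ring.
Qed.

(** Truncation commutes with multiplication by [z - a] up to one boundary term, which tends to 0 on
    the disc when [h] is bounded. [sum_div_1sub] is the analogue for division. *)
Lemma sum_mul_Xsub a h (z : K) n :
  \sum_(i < n) mul_Xsub a h i * z ^+ i =
  (z - a) * (\sum_(i < n) h i * z ^+ i) - delay h n * z ^+ n.
Proof.
elim: n => [|n IHn]; first by rewrite !big_ord0 /=; ring.
rewrite !big_ord_recr /= IHn /mul_Xsub exprS; ring.
Qed.

Lemma sum_div_1sub b g (z : K) n :
  (1 - b * z) * (\sum_(i < n) div_1sub b g i * z ^+ i) =
  \sum_(i < n) g i * z ^+ i - b * delay (div_1sub b g) n * z ^+ n.
Proof.
elim: n => [|n IHn]; first by rewrite !big_ord0 /=; ring.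
rewrite !big_ord_recr /= mulrDr IHn -[g n in RHS](div_1subK b) exprS; ring.
Qed.

End FormalOperators.

(** * Weighted sums of squared coefficients, and square summability *)

Section WeightedSums.
Variable R : realType.
Local Notation C := (Cplx R).
Implicit Types (a z : C) (g h k : nat -> C) (w : nat -> R) (N : nat).

Definition wsum w h N : R := \sum_(n < N) w n * normc (h n) ^+ 2.

(** Dividing first exposes the sequence [h] of [G / (1 - a^* z)], in terms of which both [F] and [G]
    are expressed. *)
Definition mul_blaschke a g : nat -> C := mul_Xsub a (div_1sub a^*%C g).

Lemma normc_ge0 (z : C) : 0 <= normc z.
Proof. by case: z => x y; exact: sqrtr_ge0. Qed.

Lemma cnorm0 : normc (0 : C) = 0. Proof. exact: normc0. Qed.

Lemma cnorm1 : normc (1 : C) = 1. Proof. exact: normc1. Qed.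

Lemma cnormM (x y : C) : normc (x * y) = normc x * normc y.
Proof. exact: normcM. Qed.

Lemma cnormN (x : C) : normc (- x) = normc x.
Proof. exact: normcN. Qed.

Lemma cnormJ (x : C) : normc x^*%C = normc x.
Proof. by case: x => x y; rewrite /= sqrrN. Qed.

Lemma cnorm_real (x : R) : normc (x%:C%C : C) = `|x|.
Proof. by rewrite /= expr0n addr0 sqrtr_sqr. Qed.

Lemma cnormD_le (x y : C) : normc (x + y) <= normc x + normc y.
Proof. exact: le_normcD. Qed.

Lemma cnorm_eq0 (x : C) : (normc x == 0) = (x == 0).
Proof. by apply/eqP/eqP => [/eq0_normc|->] //; exact: cnorm0. Qed.

Lemma cnormX (x : C) n : normc (x ^+ n) = normc x ^+ n.
Proof. by elim: n => [|n IHn]; rewrite ?cnorm1 // !exprS cnormM IHn. Qed.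

Lemma cnorm_sum_le I (s : seq I) (f : I -> C) :
  normc (\sum_(i <- s) f i) <= \sum_(i <- s) normc (f i).
Proof.
elim: s => [|i s IHs]; first by rewrite !big_nil cnorm0.
by rewrite !big_cons (le_trans (cnormD_le _ _)) // lerD2l.
Qed.

Lemma sqr_normc (x y : R) : normc (x +i* y)%C ^+ 2 = x ^+ 2 + y ^+ 2.
Proof. by rewrite /normc sqr_sqrtr // addr_ge0 ?sqr_ge0. Qed.

(** Both squares on the left contain the cross term [- 2 Re[a y^* x]], which cancels. The identity
    is applied with [y = h_(n-1)] and [x = h_n]. *)
Lemma normc_blaschke (a x y : C) :
  normc (y - a * x) ^+ 2 - normc (x - a^*%C * y) ^+ 2 =
  (1 - normc a ^+ 2) * (normc y ^+ 2 - normc x ^+ 2).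
Proof.
case: a x y => [a1 a2] [x1 x2] [y1 y2].
rewrite -[X in normc X ^+ 2 - _]/((y1 - (a1 * x1 - a2 * x2)) +i*
  (y2 - (a1 * x2 + a2 * x1)))%C.
rewrite -[X in _ - normc X ^+ 2]/((x1 - (a1 * y1 - (- a2) * y2)) +i*
  (x2 - (a1 * y2 + (- a2) * y1)))%C.
rewrite !sqr_normc; ring.
Qed.

(** Summation by parts, with [u_(-1) = 0]. The weights stay arbitrary so that [gamma], its
    increments and the constant 1 are all covered. *)
Lemma abel_sum (f g u : nat -> R) (c : R) w N :
    (forall n, g n = f n - c * ((if n is m.+1 then u m else 0) - u n)) ->
  \sum_(n < N.+1) w n * g n + c * (\sum_(n < N) (w n.+1 - w n) * u n) =
  \sum_(n < N.+1) w n * f n + c * (w N * u N).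
Proof.
move=> E; elim: N => [|N IHN].
  by rewrite !big_ord_recr !big_ord0 /= E; ring.
rewrite big_ord_recr [X in _ + c * X]big_ord_recr [in RHS]big_ord_recr /=.
rewrite mulrDr addrACA IHN (E N.+1); ring.
Qed.

Lemma wsum_blaschke a g w N :
  let h := div_1sub a^*%C g in
  wsum w g N.+1 + (1 - normc a ^+ 2) * wsum (fun n => w n.+1 - w n) h N =
  wsum w (mul_blaschke a g) N.+1 +
  (1 - normc a ^+ 2) * (w N * normc (h N) ^+ 2).
Proof.
move=> h; rewrite /wsum.
apply: (@abel_sum (fun n => normc (mul_blaschke a g n) ^+ 2)
  (fun n => normc (g n) ^+ 2) (fun n => normc (h n) ^+ 2)) => n.
have -> : (if n is m.+1 then normc (h m) ^+ 2 else 0) = normc (delay h n) ^+ 2.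
  by case: n => // ; rewrite [delay h 0]/(0 : C) cnorm0 expr0n.
rewrite -normc_blaschke /h div_1subK /mul_blaschke /mul_Xsub; ring.
Qed.

(** In [wsum_blaschke] the increments of [w] are nonpositive and the boundary term is nonnegative,
    so both push the same way. Constant weights give preservation of [l2], the increments of [gamma]
    the contraction in the [Y] norm. *)
Lemma wsum_blaschke_le a g w N : normc a < 1 -> (forall n, 0 <= w n) ->
    (forall n, w n.+1 <= w n) -> wsum w (mul_blaschke a g) N <= wsum w g N.
Proof.
move=> a1 w0 wd; case: N => [|N]; first by rewrite /wsum !big_ord0.
have := wsum_blaschke a g w N; rewrite /= => E.
have r0 : 0 <= 1 - normc a ^+ 2.
  by have := normc_ge0 a; nra.
have h1 : 0 <= (1 - normc a ^+ 2) * (w N * normc (div_1sub a^*%C g N) ^+ 2).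
  by apply: mulr_ge0 => //; apply: mulr_ge0 => //; apply: sqr_ge0.
have h2 : (1 - normc a ^+ 2) *
   wsum (fun n => w n.+1 - w n) (div_1sub a^*%C g) N <= 0.
  rewrite mulr_ge0_le0 // sumr_le0 // => i _.
  by rewrite mulr_le0_ge0 ?sqr_ge0 // subr_le0.
by lra.
Qed.

Definition l2 h := exists M, forall N, wsum (fun=> 1) h N <= M.

Lemma l2_mul_blaschke a g : normc a < 1 -> l2 g -> l2 (mul_blaschke a g).
Proof.
move=> a1 [M gM]; exists M => N; apply: le_trans (gM N).
exact: wsum_blaschke_le.
Qed.

(* Convexity: [(x + r y)^2 <= x^2 / (1 - r) + r y^2]. *)
Lemma l2_div_1sub b g : normc b < 1 -> l2 g -> l2 (div_1sub b g).
Proof.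
move=> b1 [M gM]; set r := normc b.
have r0 : 0 < 1 - r by rewrite subr_gt0.
have r0' : 0 <= r := normc_ge0 b.
exists (M / (1 - r) ^+ 2) => N.
suff: (1 - r) ^+ 2 * wsum (fun=> 1) (div_1sub b g) N <= M.
  by rewrite mulrC -ler_pdivlMr // exprn_gt0.
apply: le_trans (gM N).
(* The added last term closes the induction: the new coefficient enters with total factor
   [(1 - r)^2 + (1 - r) r = 1 - r], and the previous last term supplies the [(1 - r) r y^2] of the
   convexity bound. *)
suff: (1 - r) ^+ 2 * wsum (fun=> 1) (div_1sub b g) N
    + (if N is n.+1 then (1 - r) * r * normc (div_1sub b g n) ^+ 2 else 0)
    <= wsum (fun=> 1) g N.
  apply: le_trans; rewrite lerDl; case: N => // n.
  by rewrite !mulr_ge0 ?normc_ge0 ?sqr_ge0 ?ltW.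
rewrite /wsum; elim: N => [|N IHN]; first by rewrite !big_ord0 mulr0 addr0.
rewrite !big_ord_recr /= !mul1r.
case: N IHN => [|N]; rewrite ?big_ord0 /=.
  move=> _; rewrite !add0r; have := sqr_ge0 (normc (g 0%N)); nra.
set x := normc (g N.+1); set y := normc (div_1sub b g N).
set v := normc (g N.+1 + b * div_1sub b g N).
have vxy : v <= x + r * y by rewrite /v (le_trans (cnormD_le _ _)) // cnormM.
have x0 : 0 <= x := normc_ge0 _. have y0 : 0 <= y := normc_ge0 _.
have v0 : 0 <= v := normc_ge0 _.
have : v ^+ 2 <= (x + r * y) ^+ 2.
  by rewrite lerXn2r ?nnegrE // addr_ge0 ?mulr_ge0.
set S1 := \sum_(i < N.+1) _; set S2 := \sum_(i < N.+1) _ => vv IH.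
have h : (1 - r) * (x + r * y) ^+ 2 <= x ^+ 2 + (1 - r) * r * y ^+ 2.
  have : 0 <= r * (x - (1 - r) * y) ^+ 2 by rewrite mulr_ge0 ?sqr_ge0.
  by move=> ?; lra.
have : (1 - r) * v ^+ 2 <= (1 - r) * (x + r * y) ^+ 2 by rewrite ler_pM2l.
by lra.
Qed.

Definition bounded_seq h := exists2 M, 0 <= M & forall n, normc (h n) <= M.

Lemma l2_bounded h : l2 h -> bounded_seq h.
Proof.
move=> [M hM].
have M0 : 0 <= M by have := hM 0%N; rewrite /wsum big_ord0.
exists (M + 1) => [|n]; first by rewrite addr_ge0.
have : normc (h n) ^+ 2 <= M.
  apply: le_trans (hM n.+1); rewrite /wsum big_ord_recr /= mul1r lerDr.
  by apply: sumr_ge0 => i _; rewrite mul1r sqr_ge0.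
by have := normc_ge0 (h n); nra.
Qed.

End WeightedSums.

(** * Power series on the disc *)

Section PowerSeries.
Variable R : realType.
Local Notation C := (Cplx R).
Implicit Types (a b c z : C) (g h k : nat -> C) (F G : C -> C).

Lemma normCE (x : C) : `|x| = ((normc x)%:C)%C :> C.
Proof. by []. Qed.

Lemma gt0_real (e : C) : 0 < e -> exists2 x : R, e = (x%:C)%C & 0 < x.
Proof.
by case: e => x y; rewrite ltcE /= => /andP[/eqP -> ?]; exists x.
Qed.

(** Transfers limits to a real sequence, where tolerances are real rather than elements of the
    partially ordered [R[i]]. *)
Lemma cvg_normcP (u : nat -> C) (l : C) :
  u @ \oo --> l <-> (fun n => normc (l - u n)) @ \oo --> (0 : R).
Proof.
split=> [/cvgrPdist_lt ul|/cvgrPdist_lt ul]; apply/cvgrPdist_lt => e e0.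
  have e0' : 0 < (e%:C)%C :> C by rewrite ltcR.
  near=> n; rewrite sub0r normrN ger0_norm ?normc_ge0 // -ltcR -normCE.
  by near: n; exact: ul.
have [e' E e'0] := gt0_real e0.
near=> n; rewrite normCE E ltcR.
have : `|0 - normc (l - u n)| < e' by near: n; exact: ul.
by rewrite sub0r normrN ger0_norm ?normc_ge0.
Unshelve. all: by end_near. Qed.

Lemma discE z : disc z = (normc z < 1) :> Prop.
Proof. by rewrite /disc /= normCE ltcR. Qed.

(** The bound is asked only from index 1 on, because the partial sum of index 0 is empty and misses
    the head coefficient. *)
Lemma cvg_limit_le (u : nat -> C) (l c : C) (B : R) :
  u @ \oo --> l -> (forall n, normc (u n.+1 - c) <= B) -> normc (l - c) <= B.
Proof.
move=> /cvg_normcP/cvgrPdist_lt ul uB; apply/ler_addgt0Pr => e /ul.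
move=> [n _ /(_ n.+1 (leqnSn n)) /=].
rewrite sub0r normrN ger0_norm ?normc_ge0 // => ne.
have -> : l - c = (u n.+1 - c) + (l - u n.+1) by ring.
by rewrite (le_trans (cnormD_le _ _)) // lerD // ltW.
Qed.

Lemma bounded_mul_exp_cvg0 h z : bounded_seq h -> disc z ->
  (fun n => h n * z ^+ n) @ \oo --> (0 : C).
Proof.
rewrite discE => -[M M0 hM] z1; apply/cvg_normcP.
apply: (@squeeze_cvgr _ _ _ _ (fun=> 0) (fun n => M * normc z ^+ n)).
- apply: nearW => n; rewrite normc_ge0 /= sub0r cnormN cnormM cnormX.
  by rewrite ler_wpM2r ?exprn_ge0 ?normc_ge0.
- exact: cvg_cst.
- rewrite -[X in _ --> X](mulr0 M); apply: cvgMl_tmp.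
  by apply: cvg_expr; rewrite ger0_norm ?normc_ge0.
Qed.

Lemma bounded_delay h : bounded_seq h -> bounded_seq (delay h).
Proof.
move=> [M M0 hM]; exists M => // -[|n] //=.
by rewrite -[Num.sqrt _]/(normc (0 : C)) cnorm0.
Qed.

Lemma eq_has_taylor F G h : (forall z, disc z -> F z = G z) ->
  has_taylor F h -> has_taylor G h.
Proof. by move=> FG Fh z z1; rewrite -FG //; exact: Fh. Qed.

Lemma has_taylor_mul_Xsub a F h : bounded_seq h -> has_taylor F h ->
  has_taylor (fun z => (z - a) * F z) (mul_Xsub a h).
Proof.
move=> hb Fh z z1; rewrite -[X in _ --> X]subr0.
have -> : series (fun n => mul_Xsub a h n * z ^+ n) =
    (fun n => (z - a) * series (fun n => h n * z ^+ n) n - delay h n * z ^+ n).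
  by apply/funext => n; rewrite !seriesEord /= sum_mul_Xsub.
apply: cvgB; first by apply: cvgMl_tmp; exact: Fh.
by apply: bounded_mul_exp_cvg0 => //; exact: bounded_delay.
Qed.

Lemma has_taylor_div_1sub b G g : normc b < 1 ->
  bounded_seq (div_1sub b g) -> has_taylor G g ->
  has_taylor (fun z => G z / (1 - b * z)) (div_1sub b g).
Proof.
move=> b1 hb Gg z z1.
have bz : 1 - b * z != 0.
  rewrite subr_eq0 eq_sym; apply/eqP => /(congr1 (@normc R)).
  rewrite cnormM cnorm1; rewrite discE in z1.
  by have := normc_ge0 b; have := normc_ge0 z; nra.
have -> : series (fun n => div_1sub b g n * z ^+ n) =
    (fun n => (series (fun n => g n * z ^+ n) n
       - b * (delay (div_1sub b g) n * z ^+ n)) / (1 - b * z)).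
  apply/funext => n; rewrite !seriesEord /= mulrA -sum_div_1sub.
  by rewrite mulrC mulKf.
apply: cvgMr_tmp; rewrite -[X in _ --> X]subr0 -(mulr0 b); apply: cvgB.
  exact: Gg.
apply: cvgMl_tmp.
by apply: bounded_mul_exp_cvg0 => //; exact: bounded_delay.
Qed.

Lemma has_taylor_mul_blaschke a G g : normc a < 1 -> l2 g -> has_taylor G g ->
  has_taylor (fun z => (z - a) / (1 - a^*%C * z) * G z) (mul_blaschke a g).
Proof.
move=> a1 gl Gg; have a1' : normc a^*%C < 1 by rewrite cnormJ.
have hb : bounded_seq (div_1sub a^*%C g).
  exact/l2_bounded/l2_div_1sub.
apply: eq_has_taylor; last first.
  exact: has_taylor_mul_Xsub hb (has_taylor_div_1sub a1' hb Gg).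
by move=> z _ /=; rewrite mulrA mulrAC.
Qed.

(** The head dominates the tail near 0: convergence at [1/2] gives [|g_n| <= M 2^n], and a small [t]
    makes the tail smaller than [|g_0|]. Excluding [z = 0] lets the hypothesis survive division by
    [z] in [has_taylor_uniq]. *)
Lemma cvg_series0_head g :
    (forall z, disc z -> z != 0 ->
      series (fun n => g n * z ^+ n : C) @ \oo --> (0 : C)) ->
  g 0%N = 0.
Proof.
move=> gz.
have [M M0 gM] : exists2 M, 0 <= M & forall n, normc (g n) <= M * 2 ^+ n.
  have h1 : disc ((2^-1)%:C%C : C).
    rewrite discE cnorm_real ger0_norm ?invr_ge0 ?ler0n //.
    by rewrite invf_lt1 ?ltr1n ?ltr0n.
  have h2 : (2^-1)%:C%C != 0 :> C.
    by rewrite -cnorm_eq0 cnorm_real normr_eq0 invr_eq0 pnatr_eq0.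
  have /cvgP/cvg_series_cvg_0/cvgP/cvg_seq_bounded := gz _ h1 h2.
  move=> /ex_strict_bound_gt0[M /gt0_real[M' -> M0] gM].
  exists M' => [|n]; first exact: ltW.
  have := gM n I; rewrite /= normCE ltcR cnormM cnormX cnorm_real.
  rewrite ger0_norm ?invr_ge0 // exprVn ltr_pdivrMr ?exprn_gt0 //; exact: ltW.
apply/eqP; rewrite -cnorm_eq0; apply/eqP/le_anti; rewrite normc_ge0 andbT.
rewrite leNgt; apply/negP => g0; set d := normc (g 0%N) in g0.
(* With [t <= 1/4] the tail is dominated by a geometric sum of ratio [1/2], hence is at most
   [4 M t]; the witness gives [4 M t = d M / (M + d) < d]. *)
have [t [t0 t4 Mt]] : exists t : R, [/\ 0 < t, t <= 4^-1 & 4 * M * t < d].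
  have Md : 0 < M + d by lra.
  exists (d / (4 * (M + d))); split; first by rewrite divr_gt0 // mulr_gt0.
    by rewrite invfM mulrCA ler_piMr ?ler_pdivrMr //; lra.
  have -> : 4 * M * (d / (4 * (M + d))) = d * (M / (M + d)) by field; lra.
  by rewrite gtr_pMr // ltr_pdivrMr // mul1r; lra.
have nt : normc (t%:C%C : C) = t.
  by rewrite cnorm_real gtr0_norm.
have /gz : disc (t%:C%C : C) by rewrite discE nt; lra.
rewrite -cnorm_eq0 nt gt_eqF // => /(_ isT)/cvg_limit_le.
move=> /(_ (g 0%N) (4 * M * t)).
rewrite sub0r cnormN -/d => /(_ _)/wrap[n|].
  rewrite seriesEord /= big_ord_recl /= expr0 mulr1 addrC addKr.
  rewrite (le_trans (cnorm_sum_le _ _)) //.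
  apply: (@le_trans _ _ (\sum_(i < n) 2 * M * t * 2^-1 ^+ i)).
    apply: ler_sum => i _; rewrite cnormM cnormX nt /bump /= add1n.
    have := gM i.+1; rewrite !exprS => gi.
    apply: le_trans (ler_wpM2r _ gi) _.
      by rewrite mulr_ge0 ?exprn_ge0 // ltW.
    have -> : M * (2 * 2 ^+ i) * (t * t ^+ i) = 2 * M * t * (2 * t) ^+ i.
      by rewrite exprMn; ring.
    rewrite ler_wpM2l ?mulr_ge0 //; try exact: ltW.
    by rewrite lerXn2r ?nnegrE; lra.
  rewrite -mulr_sumr.
  have -> : 4 * M * t = 2 * M * t * 2 by ring.
  rewrite ler_wpM2l ?mulr_ge0 //; try exact: ltW.
  have := @geometric_le_lim R n 1 2^-1 ler01.
  rewrite seriesEord /geometric /=; under eq_bigr do rewrite mul1r.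
  have h0 : 0 < 2^-1 :> R by lra.
  have h1 : `|2^-1| < 1 :> R by rewrite gtr0_norm //; lra.
  suff -> : 1 / (1 - 2^-1) = 2 :> R by move=> /(_ h0 h1).
  by field; lra.
by apply/negP; rewrite -ltNge.
Qed.

Lemma has_taylor_uniq F g h : has_taylor F g -> has_taylor F h -> g = h.
Proof.
move=> Fg Fh; apply/funext => n; apply/eqP; rewrite -subr_eq0; apply/eqP.
pose d i := g i - h i; rewrite -/(d n).
have : forall z, disc z -> z != 0 ->
    series (fun n => d n * z ^+ n : C) @ \oo --> (0 : C).
  move=> z z1 _; rewrite -(subrr (F z)).
  have -> : series (fun n => d n * z ^+ n) =
      series (fun n => g n * z ^+ n) \- series (fun n => h n * z ^+ n).
    apply/funext => m; rewrite /= !seriesEord /= -sumrB.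
    by apply: eq_bigr => i _; rewrite -mulrBl.
  by apply: cvgB; [exact: Fg|exact: Fh].
(* The sequence is generalized: once [d_0 = 0], dividing by [z] shifts it, so the head argument
   reaches each coefficient in turn. *)
elim: n {Fg Fh g h} d => [|n IHn] d dz; first exact: cvg_series0_head.
apply: (IHn (fun i => d i.+1)) => z z1 z0.
have d0 := cvg_series0_head dz.
have -> : series (fun n => d n.+1 * z ^+ n) =
   (fun n => series (fun n => d n * z ^+ n) n.+1 * z^-1).
  apply/funext => m; rewrite !seriesEord /= big_ord_recl /= d0 mul0r add0r.
  rewrite mulr_suml; apply: eq_bigr => i _.
  by rewrite /bump /= add1n exprSr mulrA mulfK.
rewrite -[X in _ --> X](mul0r z^-1); apply: cvgMr_tmp.
by rewrite (cvg_shiftS (series (fun n => d n * z ^+ n))); exact: dz.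
Qed.

(** Plays the role of the derivative bound [sum n r^(n-1) = 1 / (1 - r)^2], through [z^(n+1) -
    a^(n+1) = z (z^n - a^n) + (z - a) a^n]. *)
Lemma sum_normc_expB_le (r : R) a z N : normc a <= r -> normc z <= r -> r < 1 ->
  (1 - r) ^+ 2 * (\sum_(n < N) normc (z ^+ n - a ^+ n)) <= normc (z - a).
Proof.
move=> ar zr r1; have a0 := normc_ge0 a; have r0 : 0 <= r by lra.
have d0 := normc_ge0 (z - a).
(* With the two added terms the left side starts at [normc (z - a)] and does not grow with [N]. *)
suff : (1 - r) ^+ 2 * (\sum_(n < N) normc (z ^+ n - a ^+ n))
   + (1 - r) * normc (z ^+ N - a ^+ N) + normc (z - a) * r ^+ N
   <= normc (z - a).
  have : 0 <= (1 - r) * normc (z ^+ N - a ^+ N).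
    by rewrite mulr_ge0 ?normc_ge0 //; lra.
  have : 0 <= normc (z - a) * r ^+ N by rewrite mulr_ge0 ?exprn_ge0.
  by lra.
elim: N => [|N IHN]; first by rewrite big_ord0 !expr0 subrr cnorm0; lra.
rewrite big_ord_recr /=.
set S := \sum_(i < N) _ in IHN *.
have : normc (z ^+ N.+1 - a ^+ N.+1) <=
    r * normc (z ^+ N - a ^+ N) + normc (z - a) * r ^+ N.
  have -> : z ^+ N.+1 - a ^+ N.+1 = z * (z ^+ N - a ^+ N) + (z - a) * a ^+ N.
    by rewrite !exprS; ring.
  rewrite (le_trans (cnormD_le _ _)) // !cnormM cnormX lerD //.
    by rewrite ler_wpM2r ?normc_ge0.
  by rewrite ler_wpM2l ?lerXn2r.
set D := normc (z ^+ N.+1 - _); move: IHN.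
set D' := normc (z ^+ N - _) => IHN DD.
have : (1 - r) * D <= (1 - r) * (r * D' + normc (z - a) * r ^+ N).
  by rewrite ler_wpM2l //; lra.
by rewrite [r ^+ N.+1]exprS; lra.
Qed.

(** A termwise estimate; it supplies the continuity needed to remove the singularity of
    [F z / (z - a)]. *)
Lemma has_taylor_lipschitz F h (r : R) : bounded_seq h -> has_taylor F h ->
    r < 1 -> exists2 M, 0 <= M &
  forall a z, normc a <= r -> normc z <= r ->
    normc (F z - F a) <= M * normc (z - a).
Proof.
move=> [M M0 hM] Fh r1; exists (M / (1 - r) ^+ 2).
  by rewrite divr_ge0 ?sqr_ge0.
move=> a z ar zr; rewrite -[F z - F a]subr0.
have a1 : disc a by rewrite discE; lra.
have z1 : disc z by rewrite discE; lra.
apply: (cvg_limit_le (cvgB (Fh z z1) (Fh a a1))) => n.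
rewrite subr0 !seriesEord /= fctE -sumrB; move: n.+1 => N.
have r2 : 0 < (1 - r) ^+ 2 by rewrite exprn_gt0; lra.
apply: (@le_trans _ _ (M * (\sum_(n < N) normc (z ^+ n - a ^+ n)))).
  rewrite (le_trans (cnorm_sum_le _ _)) // mulr_sumr; apply: ler_sum => i _.
  by rewrite -mulrBr cnormM ler_wpM2r ?normc_ge0.
rewrite -mulrA ler_wpM2l // mulrC ler_pdivlMr // mulrC.
exact: sum_normc_expB_le.
Qed.

(** Off [a] the factor cancels. At [a], the quotient is [H w] for nearby [w] distinct from [a], and
    the Lipschitz bound identifies its limit as [H a]. *)
Lemma div_root_mul_Xsub F H h a z : disc a -> bounded_seq h ->
    has_taylor H h -> (forall z, disc z -> F z = (z - a) * H z) ->
  disc z -> div_root F a z = H z.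
Proof.
move=> a1 hb Hh FH z1; rewrite /div_root; case: eqVneq => [->|za]; last first.
  by rewrite FH // mulrC mulKf // subr_eq0.
apply: cvg_lim => //; apply/cvgrPdist_lt => e e0.
have [e' E e'0] := gt0_real e0.
(* The midpoint between [|a|] and 1, so that a whole neighbourhood of [a] lies in the disc of radius
   [r]. *)
rewrite discE in a1; pose r := (1 + normc a) / 2.
have r1 : r < 1 by rewrite /r; lra.
have [M M0 HM] := has_taylor_lipschitz hb Hh r1.
(* The first bound keeps [w] in that disc, the second gives [M |a - w| < e']; [M + 1] keeps the
   denominator positive when [M = 0]. *)
pose dl := Num.min (r - normc a) (e' / (M + 1)).
have dl0 : 0 < dl.
  by rewrite lt_min divr_gt0 ?andbT //; rewrite ?/r; lra.
near=> w.
have wa : normc (a - w) < dl.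
  rewrite -ltcR -normCE; near: w; apply: nbhs_dnbhs.
  have /cvgrPdist_lt : x @[x --> a] --> a by exact: cvg_id.
  by apply; rewrite ltcR.
have [wr we] : normc (a - w) < r - normc a /\ normc (a - w) < e' / (M + 1).
  by move: wa; rewrite lt_min => /andP.
have wr' : normc w <= r.
  have -> : w = a - (a - w) by ring.
  by rewrite (le_trans (cnormD_le _ _)) // cnormN; lra.
have wna : w - a != 0.
  by rewrite subr_eq0; near: w; exact: nbhs_dnbhs_neq.
rewrite FH ?discE; last by lra.
rewrite mulrC mulKf // normCE E ltcR.
apply: le_lt_trans (HM _ _ wr' _) _; first by rewrite /r; lra.
move: we; rewrite ltr_pdivlMr; last by lra.
by have := normc_ge0 (a - w); nra.
Unshelve. all: by end_near. Qed.

End PowerSeries.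

(** * Weighted norms *)

Section WeightedSeries.
Variable R : realType.
Local Notation C := (Cplx R).
Implicit Types (a b z : C) (g h : nat -> C) (F G : C -> C) (w gamma : nat -> R).

(** [wnorm2] on coefficient sequences, independent of the choice made by [taylor_coef]. *)
Definition wseries w h : \bar R :=
  (\sum_(0 <= n <oo) (w n * normc (h n) ^+ 2)%:E)%E.

Definition increment gamma n : R := gamma n.+1 - gamma n.

Lemma nneseries_le (u : nat -> R) (B : \bar R) : (forall n, 0 <= u n) ->
  (forall N, ((\sum_(n < N) u n)%:E <= B)%E) ->
  (\sum_(0 <= n <oo) (u n)%:E <= B)%E.
Proof.
move=> u0 uB; apply: lime_le.
  by apply: is_cvg_nneseries => n _ _; rewrite lee_fin.
by apply: nearW => N; rewrite /= sumEFin big_mkord.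
Qed.

Lemma wsum_le_wseries w h N : (forall n, 0 <= w n) ->
  ((wsum w h N)%:E <= wseries w h)%E.
Proof.
move=> w0; rewrite /wsum -(big_mkord xpredT (fun n => w n * normc (h n) ^+ 2)).
rewrite -sumEFin; apply: nneseries_lim_ge => n _ _.
by rewrite lee_fin mulr_ge0 ?sqr_ge0.
Qed.

Lemma wseries_ge0 w h : (forall n, 0 <= w n) -> (0 <= wseries w h)%E.
Proof.
by move=> w0; have := wsum_le_wseries h 0%N w0; rewrite /wsum big_ord0.
Qed.

Lemma wseries_lty_l2 h : (wseries (fun=> 1%R) h < +oo)%E -> l2 h.
Proof.
move=> hoo; have h0 : (0 <= wseries (fun=> 1%R) h)%E by exact: wseries_ge0.
exists (fine (wseries (fun=> 1%R) h)) => N.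
by rewrite -lee_fin fineK ?ge0_fin_numE // wsum_le_wseries.
Qed.

Lemma wseries_blaschke_le a g w : normc a < 1 -> (forall n, 0 <= w n) ->
    (forall n, w n.+1 <= w n) ->
  (wseries w (mul_blaschke a g) <= wseries w g)%E.
Proof.
move=> a1 w0 wd; apply: nneseries_le => [n|N].
  by rewrite mulr_ge0 ?sqr_ge0.
apply: le_trans (wsum_le_wseries g N w0); rewrite lee_fin.
exact: wsum_blaschke_le.
Qed.

(* Otherwise [normc (h n) ^+ 2] would dominate a harmonic series. *)
Lemma l2_linear_weight_small (c e : R) w h N : l2 h ->
    (forall n, w n <= c * n%:R) -> 0 < e ->
  exists2 n, (N <= n)%N & w n * normc (h n) ^+ 2 <= e.
Proof.
move=> [M hM] wc e0; apply: contrapT => nex.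
have big n : (N <= n)%N -> e < w n * normc (h n) ^+ 2.
  by move=> Nn; rewrite ltNge; apply/negP => ne; apply: nex; exists n.
apply: (@dvg_harmonic R).
pose K := c / e.
(* Positivity of [c] is forced: otherwise [w N <= 0], against [big N]. *)
have c0 : 0 < c.
  rewrite ltNge; apply/negP => c0; have := big N (leqnn N); rewrite ltNge.
  move=> /negP; apply; apply: le_trans (ltW e0).
  rewrite mulr_le0_ge0 ?sqr_ge0 // (le_trans (wc N)) //.
  by rewrite mulr_le0_ge0.
have hK n : (N <= n)%N -> harmonic n <= K * normc (h n) ^+ 2.
  move=> Nn; rewrite /harmonic /= -[_^-1]mul1r ler_pdivrMr ?ltr0n //.
  have -> : K * normc (h n) ^+ 2 * n.+1%:R = c * n.+1%:R * normc (h n) ^+ 2 / e.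
    by rewrite /K; ring.
  rewrite ler_pdivlMr // mul1r; apply: le_trans (ltW (big n Nn)) _.
  rewrite ler_wpM2r ?sqr_ge0 // (le_trans (wc n)) // ler_wpM2l ?ler_nat //.
  exact: ltW.
(* The comparison starts at [N]; the earlier harmonic terms are kept as a constant. *)
have hN n : series harmonic (N + n)%N <=
    series harmonic N + K * wsum (fun=> 1) h (N + n)%N :> R.
  elim: n => [|n IHn].
    rewrite addn0 lerDl mulr_ge0 //; first by rewrite divr_ge0 ?ltW.
    apply: sumr_ge0 => i _.
    by rewrite mul1r sqr_ge0.
  rewrite addnS seriesSr /wsum big_ord_recr /= mul1r mulrDr.
  by rewrite addrA lerD // hK // leq_addr.
have hinc : nondecreasing_seq (series (@harmonic R)).
  by apply: nondecreasing_series => n _ _; exact: harmonic_ge0.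
apply: nondecreasing_is_cvgn => //.
exists (series harmonic N + K * M) => _ [n _ <-].
apply: le_trans (hinc _ _ (leq_addl N n)) _; apply: le_trans (hN n) _.
by rewrite lerD2l ler_wpM2l // divr_ge0 ?ltW.
Qed.

(** * Concave weights: one Blaschke factor, then finitely many *)

Section ConcaveWeight.
Variable gamma : nat -> R.
Hypothesis gamma_incr : {homo gamma : m n / (m <= n)%N >-> m <= n}.
Hypothesis gamma0 : gamma 0%N = 0.
Hypothesis gamma_concave : forall n, gamma n.+2 - 2 * gamma n.+1 + gamma n <= 0.

Lemma gamma_ge0 n : 0 <= gamma n.
Proof. by rewrite -gamma0 gamma_incr. Qed.

Lemma increment_ge0 n : 0 <= increment gamma n.
Proof. by rewrite subr_ge0 gamma_incr. Qed.

Lemma increment_decr n : increment gamma n.+1 <= increment gamma n.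
Proof. by have := gamma_concave n; rewrite /increment; lra. Qed.

(** Concavity bounds every increment by the first, which is [gamma 1] as [gamma 0 = 0]; the
    increments then telescope. *)
Lemma gamma_linear n : gamma n <= gamma 1%N * n%:R.
Proof.
have incr1 m : increment gamma m <= gamma 1%N.
  elim: m => [|m IHm]; first by rewrite /increment gamma0 subr0.
  exact: le_trans (increment_decr m) IHm.
elim: n => [|n IHn]; first by rewrite gamma0 mulr0.
by have := incr1 n; rewrite /increment -natr1; lra.
Qed.

(** Limit form of [wsum_blaschke]. The sums on the left grow with [N], so a boundary term that is
    small for arbitrarily large [N] suffices. Adding rather than subtracting keeps the statement
    meaningful for infinite values. *)
Lemma wseries_blaschke_ge a g : normc a < 1 -> l2 g ->
  (wseries gamma g + (1 - normc a ^+ 2)%:E *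
     wseries (increment gamma) (div_1sub a^*%C g)
   <= wseries gamma (mul_blaschke a g))%E.
Proof.
move=> a1 gl; set h := div_1sub _ _; set c := 1 - normc a ^+ 2.
have c0 : 0 <= c by have := normc_ge0 a; rewrite /c; nra.
have hl : l2 h by apply: l2_div_1sub; rewrite ?cnormJ.
pose P N := wsum gamma g N.+1 + c * wsum (increment gamma) h N.
have Pinc : nondecreasing_seq P.
  apply/nondecreasing_seqP => n; rewrite /P /wsum.
  rewrite [X in _ <= X + _]big_ord_recr [X in _ <= _ + c * X]big_ord_recr /=.
  apply: lerD; first by rewrite lerDl mulr_ge0 ?gamma_ge0 ?sqr_ge0.
  by rewrite ler_wpM2l // lerDl mulr_ge0 ?increment_ge0 ?sqr_ge0.
have PX N : ((P N)%:E <= wseries gamma (mul_blaschke a g))%E.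
  apply/lee_addgt0Pr => e e0.
  (* Dividing by [c + 1] keeps [c] times the boundary term at most [e]. *)
  have e1 : 0 < e / (c + 1) by rewrite divr_gt0 //; lra.
  have [n Nn gn] := l2_linear_weight_small N hl gamma_linear e1.
  apply: (@le_trans _ _ (P n)%:E); first by rewrite lee_fin Pinc.
  rewrite /P wsum_blaschke EFinD leeD //.
    exact: wsum_le_wseries gamma_ge0.
  rewrite lee_fin -/h -/c; apply: le_trans (ler_wpM2l c0 gn) _.
  by rewrite mulrCA ger_pMr // ler_pdivrMr; lra.
rewrite /wseries -nneseriesZl; last first.
  by move=> n _; rewrite lee_fin mulr_ge0 ?increment_ge0 ?sqr_ge0.
rewrite -nneseriesD; first last.
- by move=> n _ _; rewrite -EFinM lee_fin mulr_ge0 //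
    mulr_ge0 ?increment_ge0 ?sqr_ge0.
- by move=> n _ _; rewrite lee_fin mulr_ge0 ?gamma_ge0 ?sqr_ge0.
apply: nneseries_le => [n|N].
  apply: addr_ge0; first by rewrite mulr_ge0 ?gamma_ge0 ?sqr_ge0.
  by rewrite mulr_ge0 // mulr_ge0 ?increment_ge0 ?sqr_ge0.
(* [P N] also contains the nonnegative term [gamma_N |g_N|^2], which the partial sum of length [N]
   lacks. *)
apply: le_trans (PX N); rewrite lee_fin /P /wsum big_split /= -mulr_sumr.
by rewrite lerD2r big_ord_recr lerDl /= mulr_ge0 ?gamma_ge0 ?sqr_ge0.
Qed.

(** Induction on the zeros, with [k c] the coefficients of the quotient of [f] by [z - c]. A new
    factor at [a] multiplies the older quotients by a Blaschke factor, which does not increase their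
    [Y] norms, and adds the quotient [f / (1 - a^* z)]. The functions [H] serve to identify [k c]
    with the coefficients of [div_root]. *)
Lemma blaschke_coef (s : seq C) G g : (forall a, a \in s -> normc a < 1) ->
    l2 g -> has_taylor G g ->
  exists f (k : C -> nat -> C),
    [/\ l2 f, has_taylor (fun z => blaschke s z * G z) f,
        forall a, a \in s ->
          [/\ f = mul_Xsub a (k a), l2 (k a) & exists H, has_taylor H (k a)] &
        (wseries gamma g + \sum_(a <- s) (1 - normc a ^+ 2)%:E *
           wseries (increment gamma) (k a) <= wseries gamma f)%E].
Proof.
move=> s1 gl Gg; elim: s s1 => [|a s IHs] s1.
  exists g, (fun=> g); split; [exact: gl| |by []|by rewrite big_nil adde0].
  by apply: eq_has_taylor Gg => z _; rewrite /blaschke big_nil mul1r.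
have [f [k [fl Ff fk gf]]] :=
  IHs (fun b bs => s1 b (mem_behead (s := a :: s) bs)).
have a1 : normc a < 1 by apply: s1; rewrite mem_head.
have a1' : normc a^*%C < 1 by rewrite cnormJ.
have hl : l2 (div_1sub a^*%C f) by exact: l2_div_1sub.
(* [k] is indexed by points, so a repeated zero must receive a single quotient. If [a] already
   occurs in [s], the two prescriptions agree because the operators commute. *)
pose k' c := if c == a then div_1sub a^*%C f else mul_blaschke a (k c).
have k'E c : c \in s -> k' c = mul_blaschke a (k c).
  move=> /fk[fE _ _]; rewrite /k'; case: eqP => // ca.
  apply/funext => n; rewrite fE.
  have -> : mul_Xsub c (k c) = (fun n => mul_Xsub c (k c) n) by [].
  by rewrite div_1sub_mul_Xsub ca.
exists (mul_blaschke a f), k'; split.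
- exact: l2_mul_blaschke.
- apply: eq_has_taylor (has_taylor_mul_blaschke a1 fl Ff) => z _.
  by rewrite /blaschke big_cons mulrA.
- move=> c; rewrite inE; case: (boolP (c \in s)) => [cs _|_ /orP[/eqP -> |//]].
    rewrite k'E //; have [fE kl [H Hk]] := fk c cs; split.
    + apply/funext => n; rewrite /mul_blaschke mul_Xsub_comm; congr mul_Xsub.
      by apply/funext => m; rewrite fE -div_1sub_mul_Xsub.
    + exact: l2_mul_blaschke.
    + by eexists; exact: has_taylor_mul_blaschke Hk.
  rewrite /k' eqxx; split=> //.
  by eexists; apply: has_taylor_div_1sub Ff => //; exact: l2_bounded.
- apply: le_trans (wseries_blaschke_ge a1 fl); rewrite big_cons {1}/k' eqxx.
  rewrite addeCA addeC leeD2r //; apply: le_trans gf; rewrite leeD2l //.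
  rewrite !big_seq; apply: lee_sum => c cs; rewrite k'E //.
  have c1 : normc c < 1 by apply: s1; rewrite inE cs orbT.
  apply: lee_wpmul2l.
    by rewrite lee_fin; have := normc_ge0 c; nra.
  exact: wseries_blaschke_le increment_ge0 increment_decr.
Qed.

End ConcaveWeight.

(** * From coefficient sequences back to functions *)

Lemma taylor_coefP F : analytic_on_disc F -> has_taylor F (taylor_coef F).
Proof.
move=> [a Fa].
by apply: (@xgetPex _ (fun=> 0) [set a | has_taylor F a]); exists a.
Qed.

Lemma taylor_coefE F h : has_taylor F h -> taylor_coef F = h.
Proof.
move=> Fh; apply: (@has_taylor_uniq _ F) => //.
by apply: taylor_coefP; exists h.
Qed.

End WeightedSeries.

Theorem theorem5 (R : realType) (gamma : nat -> R)
    (gamma_incr : {homo gamma : m n / (m <= n)%N >-> m <= n})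
    (gamma_neq0 : exists n, gamma n != 0)
    (gamma0 : gamma 0%N = 0)
    (gamma_concave : forall n, gamma n.+2 - 2 * gamma n.+1 + gamma n <= 0)
    (F G : Cplx R -> Cplx R) (alpha : seq (Cplx R))
    (F_X : spaceX gamma F)
    (F_zeros : zeros_in_disc F alpha)
    (F_BG : blaschke_decomposition F alpha G) :
  (normX2 gamma G <=
   normX2 gamma F -
   \sum_(a <- alpha)
     ((1 - normc a ^+ 2)%:E * normY2 gamma (div_root F a)))%E.
Proof.
have [[Ga Goo] _ FBG] := F_BG; have [_ Foo] := F_X.
have alpha1 a : a \in alpha -> normc a < 1.
  by move=> /(proj1 F_zeros); rewrite discE.
have Gg := taylor_coefP Ga; have gl := wseries_lty_l2 Goo.
have [f [k [_ Ff fk gf]]] :=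
  blaschke_coef gamma_incr gamma0 gamma_concave alpha1 gl Gg.
have {}Ff : has_taylor F f by apply: eq_has_taylor Ff => z z1; rewrite FBG.
have FE := taylor_coefE Ff.
have kE a : a \in alpha -> taylor_coef (div_root F a) = k a.
  move=> aa; have [fE kl [H Hk]] := fk a aa.
  have kb := l2_bounded kl; apply: taylor_coefE.
  apply: eq_has_taylor (Hk) => z z1.
  have a1 : disc a by rewrite discE; exact: alpha1.
  symmetry; apply: (@div_root_mul_Xsub _ F H (k a) a z) => // w w1.
  (* Since [f = mul_Xsub a (k a)], the same series converges to [F w] and to [(w - a) H w], which
     gives the factorization. *)
  have := @has_taylor_mul_Xsub _ a _ _ kb Hk; rewrite -fE => aHf.
  exact: cvg_unique (Ff w w1) (aHf w w1).
have -> : (\sum_(a <- alpha)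
     ((1 - normc a ^+ 2)%:E * normY2 gamma (div_root F a)))%E =
  (\sum_(a <- alpha) (1 - normc a ^+ 2)%:E * wseries (increment gamma) (k a))%E.
  rewrite !big_seq; apply: eq_bigr => a aa.
  by rewrite /normY2 /wnorm2 kE.
set S := (\sum_(a <- alpha) _)%E in gf *.
have {}Foo : (wseries gamma f < +oo)%E by rewrite -FE.
have S0 : (0 <= S)%E.
  rewrite /S big_seq; apply: sume_ge0 => a /alpha1 a1; apply: mule_ge0.
    by rewrite lee_fin; have := normc_ge0 a; nra.
  exact/wseries_ge0/increment_ge0.
have g0 : (0 <= wseries gamma (taylor_coef G))%E.
  by apply/wseries_ge0 => n; exact: gamma_ge0.
(* [S] is bounded by the finite squared [X] norm of [F]; finiteness permits moving it across the
   inequality in the extended reals. *)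
have Sf : S \is a fin_num.
  rewrite ge0_fin_numE //; apply: le_lt_trans Foo; apply: le_trans gf.
  by rewrite leeDr.
rewrite leeBrDr; last exact: Sf.
by rewrite /normX2 /wnorm2 FE; exact: gf.
Qed.
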